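(* Let $\Gamma$, $X$, $D\ge 3$, $\{E_i\}_{i=0}^D$, $q,a,\alpha,\varepsilon$ and $k_i$ be as in the context, and assume condition $(\ast)$ holds for every choice of base vertex $x\in X$. Let $0\neq f\in\mathbb C$ and put $\mathsf W=f\sum_{i=0}^D\tau_iE_i$, where $\tau_i=(-1)^ia^{-i}q^{i(D-i)}$. Then the following are equivalent: (i) $\mathsf W$ is a spin model; (ii) $f^2=|X|^{1/2}\sum_{i=0}^D\tau_i^{-1}k_i$.
   Context: Let $\Gamma$ be a finite, undirected, connected graph without loops or multiple edges, with vertex set $X$, path-length distance $\partial$, and diameter $D\ge3$. For $y\in X$ and $0\le i\le D$ let $\Gamma_i(y)=\{z\in X:\partial(y,z)=i\}$. Assume $\Gamma$ is distance-regular: for $0\le h,i,j\le D$ and $y,z\in X$ with $\partial(y,z)=h$, the number $p^h_{i,j}=|\Gamma_i(y)\cap\Gamma_j(z)|$ depends only on $h,i,j$; write $k_i=p^0_{i,i}$. Matrices lie in $\mathrm{Mat}_X(\mathbb C)$ (rows and columns indexed by $X$); $I$ is the identity and $J$ the all-ones matrix. $A_i$ is the $i$th distance matrix ($(A_i)_{y,z}=1$ if $\partial(y,z)=i$, else $0$), $A=A_1$, and $M=\mathrm{span}\{A_0,\dots,A_D\}$ is the Bose–Mesner algebra. Let $E_0,\dots,E_D$ be an ordering of the primitive idempotents of $M$ ($E_iE_j=\delta_{ij}E_i$, $\sum_iE_i=I$, $E_0=|X|^{-1}J$), with $A=\sum_i\theta_iE_i$. Define matrices $P,Q$ (rows/columns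 indexed by $0,\dots,D$) by $A_j=\sum_iP_{i,j}E_i$, $E_j=|X|^{-1}\sum_iQ_{i,j}A_i$. Assume the ordering is formally self-dual ($P=Q$) and that there are $q,a,\alpha,\varepsilon\in\mathbb C$ with $q\ne0$, $q^2\ne\pm1$, $a\ne0$, $\alpha\ne0$ and $\theta_i=\alpha(aq^{2i-D}+a^{-1}q^{D-2i})+\varepsilon$ $(0\le i\le D)$. Write $\vartheta_i=aq^{2i-D}+a^{-1}q^{D-2i}$. For a base vertex $x\in X$: $E^*_i=E^*_i(x)$ is the diagonal matrix with $(y,y)$-entry $1$ if $\partial(x,y)=i$ and $0$ otherwise; $A^*=A^*(x)$ is the diagonal matrix with $(y,y)$-entry $|X|(E_1)_{x,y}$. Put $\mathsf A=(A-\varepsilon I)/\alpha$, $\mathsf B=(A^*-\varepsilon I)/\alpha$. Condition $(\ast)$ for $x$: $\sum_{i=0}^DE^*_i\mathsf AE^*_i\bigl(1+\frac{\vartheta_i}{q+q^{-1}}\bigr)=\sum_{i=0}^DE_i\mathsf BE_i\bigl(1+\frac{\vartheta_i}{q+q^{-1}}\bigr)$. A matrix $W\in\mathrm{Mat}_X(\mathbb C)$ is type II if all its entries are nonzero and $WW^{(-)}\in\mathrm{span}(I)$, where $W^{(-)}_{b,c}=1/W_{c,b}$. $W$ is a spin model if it is symmetric, type II, and for all $b,c,d\in X$: $\sum_{e\in X}\frac{W_{e,c}W_{e,d}}{W_{e,b}}=|X|^{1/2}\frac{W_{c,d}}{W_{b,c}W_{d,b}}$, where $|X|^{1/2}>0$.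 *)

(* Defs.v *)
From HB Require Import structures.
From mathcomp Require Import all_boot all_order all_algebra.

Set Implicit Arguments.
Unset Strict Implicit.
Unset Printing Implicit Defensive.

Import Order.TTheory GRing.Theory Num.Theory.

Local Open Scope ring_scope.

Section Graphs.
Variables (X : finType) (e : rel X).

Definition walk (n : nat) (y z : X) : bool :=
  [exists p : n.-tuple X, path e y p && (last y p == z)].

(* Any two vertices joined by a walk are joined by one of length less than
   #|X|; [gdist] takes the junk value #|X| on unconnected pairs. *)
Definition gdist (y z : X) : nat :=
  find (fun n => walk n y z) (iota 0 #|X|).

Definition diameter : nat := (\max_(y : X) \max_(z : X) gdist y z)%N.

Definition sphere (i : nat) (y : X) : {set X} := [set z | gdist y z == i].

Definition connected_simple_graph : Prop :=
  [/\ symmetric e, irreflexive e & forall y z : X, connect e y z].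

(* [p h i j] is the intersection number p^h_{i,j}; its values outside
   [0, diameter]^3 are irrelevant. *)
Definition distance_regular (p : nat -> nat -> nat -> nat) : Prop :=
  forall h i j : nat,
    (h <= diameter)%N -> (i <= diameter)%N -> (j <= diameter)%N ->
  forall y z : X, gdist y z = h ->
    #|sphere i y :&: sphere j z| = p h i j.

End Graphs.

(* Matrices with rows and columns indexed by X are matrices of size #|X|,
   the vertices being numbered by [enum_rank] / [enum_val]. *)
Section Matrices.
Variables (C : numClosedFieldType) (X : finType) (e : rel X).
Local Notation MatX := 'M[C]_#|X|.

Definition dist_mx (i : nat) : MatX :=
  \matrix_(u, v) (gdist e (enum_val u) (enum_val v) == i)%:R.

Definition bose_mesner (D : nat) : {vspace MatX} :=
  <<[seq dist_mx i | i : 'I_D.+1]>>%VS.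

Definition idempotent_in (M : {vspace MatX}) (F : MatX) : Prop :=
  F \in M /\ F *m F = F.

Definition primitive_idempotent (M : {vspace MatX}) (F : MatX) : Prop :=
  [/\ idempotent_in M F, F != 0 &
      forall G H : MatX, idempotent_in M G -> idempotent_in M H ->
        G *m H = 0 -> H *m G = 0 -> F = G + H -> G = 0 \/ H = 0].

Definition primitive_idempotent_ordering (D : nat) (E : 'I_D.+1 -> MatX) :
    Prop :=
  [/\ injective E,
      forall F : MatX,
        primitive_idempotent (bose_mesner D) F <-> exists i, F = E i,
      forall i j, E i *m E j = if i == j then E i else 0,
      \sum_i E i = 1%:M &
      E ord0 = (#|X|%:R)^-1 *: const_mx 1].

Definition eigenmatrices (D : nat) (E : 'I_D.+1 -> MatX)
    (P Q : 'M[C]_D.+1) : Prop :=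
  (forall j : 'I_D.+1, dist_mx j = \sum_i P i j *: E i) /\
  (forall j : 'I_D.+1, E j = (#|X|%:R)^-1 *: \sum_i Q i j *: dist_mx i).

Definition dual_idem (x : X) (i : nat) : MatX :=
  diag_mx (\row_u (gdist e x (enum_val u) == i)%:R).

(* [inord 1] is the index 1, as soon as 0 < D. *)
Definition dual_adj (D : nat) (E : 'I_D.+1 -> MatX) (x : X) : MatX :=
  diag_mx (\row_u (#|X|%:R * E (inord 1) (enum_rank x) u)).

Definition vartheta (D : nat) (q a : C) (i : nat) : C :=
  a * q ^ (2 * i%:Z - D%:Z) + a^-1 * q ^ (D%:Z - 2 * i%:Z).

Definition condition_star (D : nat) (E : 'I_D.+1 -> MatX)
    (q a alpha eps : C) (x : X) : Prop :=
  let A := alpha^-1 *: (dist_mx 1 - eps%:M) in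
  let B := alpha^-1 *: (dual_adj E x - eps%:M) in
  let w (i : 'I_D.+1) := 1 + vartheta D q a i / (q + q^-1) in
  \sum_(i < D.+1) w i *: (dual_idem x i *m A *m dual_idem x i) =
  \sum_(i < D.+1) w i *: (E i *m B *m E i).

Definition tau (D : nat) (q a : C) (i : nat) : C :=
  (-1) ^+ i * a ^- i * q ^+ (i * (D - i)).

End Matrices.

Section SpinModels.
Variables (C : numClosedFieldType) (n : nat).

Definition minus_mx (W : 'M[C]_n) : 'M[C]_n := \matrix_(b, c) (W c b)^-1.

Definition type_II (W : 'M[C]_n) : Prop :=
  (forall b c, W b c != 0) /\ (exists s : C, W *m minus_mx W = s%:M).

(* [sqrtC] of a nonnegative number is its nonnegative square root. *)
Definition spin_model (W : 'M[C]_n) : Prop :=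
  [/\ W^T = W, type_II W &
      forall b c d : 'I_n,
        \sum_(u < n) W u c * W u d / W u b =
        sqrtC n%:R * (W c d / (W b c * W d b))].

End SpinModels.

(* Main.v *)
(** Fix a base vertex [x], let [A = \sum_i vartheta_i E_i],
    [B = \sum_i vartheta_i E*_i], [T = \sum_i tau_i E_i] and
    [T* = \sum_i tau_i E*_i].  Both [B] relative to the [E_i] and [A] relative
    to the [E*_i] are block tridiagonal, the former because formal self-duality
    turns Krein parameters into intersection numbers.  Comparing blocks, the
    two sides of condition (star) are [T^-1 B T + K] and [T* A T*^-1 + K] with
    the same [K], a multiple of [q A B - q^-1 B A].  Hence [T T* A = B T T*],
    so [T T* E_i = E*_i T T*] for all [i], and the braid relation
    [T T* T = T* T T*] follows on summing with the weights [tau_i].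
    The case [i = 0] for all [x] says that the [(y, z)]-entry of [T] is
    [s / tau_k], with [k] the distance from [y] to [z], and that [T] is
    type II; the row sums of [T] are [1], so [s^-1 = \sum_i k_i / tau_i].
    In these terms the spin model equation for [f T] is the braid relation up
    to a scalar factor, which is right exactly if [f^2 s = sqrt |X|]. *)

Require Import Defs.
From HB Require Import structures.
From mathcomp Require Import all_boot all_order all_algebra.
From mathcomp Require Import reals complex.
From mathcomp Require Import ring zify.

Set Implicit Arguments.
Unset Strict Implicit.
Unset Printing Implicit Defensive.

Import Order.TTheory GRing.Theory Num.Theory.

Local Open Scope ring_scope.

(** * Path-length distance in a finite connected graph *)

Section Distance.
Variables (X : finType) (e : rel X).
Local Notation d := (gdist e).

Lemma walkP n y z :
  reflect (exists p, [/\ size p = n, path e y p & last y p = z]) (walk e n y z).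
Proof.
apply: (iffP existsP) => [[p /andP[ep /eqP lp]]|[p [sp ep lp]]].
  by exists p; rewrite size_tuple.
by move/eqP: sp => sp; exists (Tuple sp); rewrite ep lp eqxx.
Qed.

Lemma gdist_le n y z : walk e n y z -> (d y z <= n)%N.
Proof.
move=> w; have [ltn|leX] := ltnP n #|X|; last first.
  (* [find] never exceeds the length of the list searched, here [#|X|]. *)
  by apply: leq_trans leX; rewrite /gdist -{2}(size_iota 0 #|X|) find_size.
rewrite leqNgt; apply/negP => /(before_find 0%N).
by rewrite nth_iota // add0n w.
Qed.

Hypothesis graph_e : connected_simple_graph e.

(** A walk shortens to a duplicate-free one, of length below [#|X|], so the search succeeds and the
    junk value does not occur. *)
Lemma gdist_walk y z : walk e (d y z) y z.
Proof.
have [_ _ /(_ y z)/connectP[p0 ep0 ->]] := graph_e.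
have [p ep up _] := shortenP ep0.
set z' := last y p.
have sp : (size p < #|X|)%N.
  by rewrite -[_.+1]/(size (y :: p)) -(card_uniqP up) max_card.
have hw : has (fun n => walk e n y z') (iota 0 #|X|).
  by apply/hasP; exists (size p); [rewrite mem_iota | apply/walkP; exists p].
have := nth_find 0%N hw; rewrite nth_iota ?add0n //.
by move: hw; rewrite has_find size_iota.
Qed.

Lemma gdist_eq0 y z : (d y z == 0%N) = (y == z).
Proof.
apply/eqP/eqP => [dyz|<-]; last first.
  by apply/eqP; rewrite -leqn0; apply/gdist_le/walkP; exists [::].
by have /walkP[p [/eqP]] := gdist_walk y z; rewrite dyz size_eq0 => /eqP->.
Qed.

Lemma gdist_sym y z : d y z = d z y.
Proof.
suff le y' z' : (d z' y' <= d y' z')%N by apply/eqP; rewrite eqn_leq !le.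
have [se _ _] := graph_e.
have /walkP[p [sp ep lp]] := gdist_walk y' z'.
apply/gdist_le/walkP; exists (rev (belast y' p)).
rewrite size_rev size_belast; split=> //.
  by rewrite -lp rev_path (eq_path (e' := e)).
by case: p {sp ep} lp => [/= <- //|w p lp]; rewrite /= rev_cons last_rcons.
Qed.

Lemma gdist_edge y w z : e y w -> (d y z <= (d w z).+1)%N.
Proof.
move=> yw; have /walkP[p [sp ep lp]] := gdist_walk w z.
by apply/gdist_le/walkP; exists (w :: p); split; rewrite //= ?sp // yw.
Qed.

Lemma gdist_step y z k : d y z = k.+1 -> exists2 w, e y w & d w z = k.
Proof.
move=> dyz; have /walkP[p] := gdist_walk y z; rewrite dyz.
case: p => [[]//|w p] [[sp] /andP[yw ep] lp].
exists w => //; apply/eqP; rewrite eqn_leq -ltnS -[X in _ && X]ltnS.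
rewrite -dyz gdist_edge //.
by rewrite andbT dyz !ltnS; apply/gdist_le/walkP; exists p.
Qed.

Lemma gdist_eq1 y z : (d y z == 1%N) = e y z.
Proof.
have [_ ie _] := graph_e.
apply/eqP/idP => [/gdist_step[w yw /eqP]|yz].
  by rewrite gdist_eq0 => /eqP<-.
apply/eqP; rewrite eqn_leq lt0n gdist_eq0; apply/andP; split.
  by apply/gdist_le/walkP; exists [:: z]; split; rewrite //= yz.
by apply: contraTneq yz => ->; rewrite ie.
Qed.

Lemma gdist_le_diameter y z : (d y z <= diameter e)%N.
Proof.
apply: leq_trans (leq_bigmax_cond (F := fun y => \max_z d y z) y isT).
exact: (leq_bigmax_cond (F := d y) z isT).
Qed.

(** Descending induction from the diameter: the first step of a geodesic lowers the distance by
    one. *)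
Lemma gdist_attained k :
  (0 < #|X|)%N -> (k <= diameter e)%N -> exists y z, d y z = k.
Proof.
move=> X0; move: {2}(diameter e - k)%N (erefl (diameter e - k)%N) => m.
elim: m k => [|m IH] k.
  move/eqP; rewrite subn_eq0 => lek kle.
  have -> : k = diameter e by apply/eqP; rewrite eqn_leq lek kle.
  rewrite /diameter.
  have [y ->] := @bigop.eq_bigmax X (fun y => \max_z d y z)%N X0.
  by have [z ->] := @bigop.eq_bigmax X (d y) X0; exists y, z.
move=> em kle.
have [||y [z /gdist_step[w _ dwz]]] := IH k.+1; [lia|lia|].
by exists w, z.
Qed.

End Distance.

(** * Complete systems of orthogonal idempotents and their spectral sums *)

Section Resolution.
Variables (K : fieldType) (I : finType) (n : nat).
Implicit Types (F : I -> 'M[K]_n) (g h w : I -> K) (Y : 'M[K]_n).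

Definition resolution F : Prop :=
  (forall i j, F i *m F j = if i == j then F i else 0) /\ \sum_i F i = 1%:M.

Definition spectral F g : 'M[K]_n := \sum_i g i *: F i.

Lemma spectral_mull F g i : resolution F -> F i *m spectral F g = g i *: F i.
Proof.
case=> FF _; rewrite mulmx_sumr (bigD1 i) //= -scalemxAr FF eqxx big1 ?addr0 //.
by move=> j /negPf ji; rewrite -scalemxAr FF eq_sym ji scaler0.
Qed.

Lemma spectral_mulr F g i : resolution F -> spectral F g *m F i = g i *: F i.
Proof.
case=> FF _; rewrite mulmx_suml (bigD1 i) //= -scalemxAl FF eqxx big1 ?addr0 //.
by move=> j /negPf ji; rewrite -scalemxAl FF ji scaler0.
Qed.

Lemma spectralV F g : resolution F -> (forall i, g i != 0) ->
  spectral F g *m spectral F (fun i => (g i)^-1) = 1%:M.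
Proof.
move=> rF g0; rewrite mulmx_sumr -(proj2 rF); apply: eq_bigr => i _.
by rewrite -scalemxAr spectral_mulr // scalerA mulVf ?scale1r.
Qed.

(** Peirce decomposition: inserting [\sum_i F i = 1] on both sides recovers a matrix from its
    blocks. *)
Lemma resolution_ext F Y Z : resolution F ->
  (forall i j, F i *m Y *m F j = F i *m Z *m F j) -> Y = Z.
Proof.
move=> [_ F1] eYZ; rewrite -[Y]mul1mx -[Y in LHS]mulmx1.
rewrite -[Z]mul1mx -[Z in RHS]mulmx1.
rewrite -F1 !mulmxA !mulmx_suml; apply: eq_bigr => i _.
by rewrite !mulmx_sumr; apply: eq_bigr => j _; rewrite eYZ.
Qed.

Lemma resolution_extr F Y Z : resolution F ->
  (forall j, Y *m F j = Z *m F j) -> Y = Z.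
Proof.
move=> rF eYZ; apply: (resolution_ext rF) => i j.
by rewrite -!mulmxA eYZ.
Qed.

(* Both sides have the same blocks [F i *m _ *m F j]. *)
Lemma block_diag_spectral F Y g h u v w : resolution F ->
  (forall i j, (g i * h j + u i + v j) *: (F i *m Y *m F j) =
               if i == j then w i *: (F i *m Y *m F i) else 0) ->
  \sum_i w i *: (F i *m Y *m F i) =
  spectral F g *m Y *m spectral F h + spectral F u *m Y + Y *m spectral F v.
Proof.
move=> rF e_coef; apply: (resolution_ext rF) => i j.
have -> : F i *m (\sum_k w k *: (F k *m Y *m F k)) *m F j =
          if i == j then w i *: (F i *m Y *m F i) else 0.
  rewrite mulmx_sumr mulmx_suml (bigD1 i) //= big1 ?addr0 => [|k ki].
    rewrite -scalemxAr -scalemxAl !mulmxA (proj1 rF) eqxx.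
    rewrite -[_ *m _ *m F j]mulmxA (proj1 rF).
    by case: eqP => [->|_]; rewrite ?mulmx0 ?scaler0.
  rewrite -scalemxAr -scalemxAl !mulmxA (proj1 rF) eq_sym (negPf ki).
  by rewrite !mul0mx scaler0.
rewrite -e_coef !(mulmxDl, mulmxDr) !mulmxA !spectral_mull //.
rewrite -!scalemxAl -!mulmxA !spectral_mulr // -!scalemxAr !scalerA -!scalerDl.
by [].
Qed.

(* The rows and the columns of the intertwining relation are separated by the
   distinct eigenvalues [g i]. *)
Lemma intertwine_idem F G g Y : resolution F -> resolution G -> injective g ->
  spectral G g *m Y = Y *m spectral F g -> forall i, G i *m Y = Y *m F i.
Proof.
move=> rF rG inj_g eY.
have off i j : i != j -> G i *m Y *m F j = 0.
  move=> ij; have : (g i - g j) *: (G i *m Y *m F j) = 0.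
    rewrite scalerBl !scalemxAl -spectral_mull // -!mulmxA.
    rewrite (mulmxA (spectral G g)) eY.
    rewrite -(mulmxA Y) spectral_mulr // -!scalemxAr.
    by rewrite !mulmxA scalemxAl scalemxAl subrr.
  move/eqP; rewrite scaler_eq0 subr_eq0 => /orP[/eqP/inj_g eij|/eqP //].
  by rewrite eij eqxx in ij.
move=> i; rewrite -[LHS]mulmx1 -(proj2 rF) mulmx_sumr (bigD1 i) //=.
rewrite big1 ?addr0; last first.
  by move=> j ji; rewrite off // eq_sym.
rewrite -[Y in RHS]mul1mx -(proj2 rG) !mulmx_suml (bigD1 i) //=.
rewrite [in RHS]big1 ?addr0 //.
by move=> j ji; rewrite off.
Qed.

End Resolution.

(** * Scalar identities for the eigenvalues and the [tau] weights *)

Section QRacah.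
Variables (C : numClosedFieldType) (D : nat) (q a : C).
Hypotheses (q_neq0 : q != 0) (q2_neq1 : q ^+ 2 != 1) (q2_neqN1 : q ^+ 2 != -1).
Hypothesis a_neq0 : a != 0.
Local Notation th := (vartheta D q a).
Local Notation t := (tau D q a).

Lemma tau_neq0 i : t i != 0.
Proof. by rewrite /tau !mulf_neq0 ?signr_eq0 ?invr_neq0 ?expf_neq0. Qed.

Lemma tau0 : t 0 = 1.
Proof. by rewrite /tau mul0n !expr0 invr1 !mulr1. Qed.

(* [eta = a q^(2i+1-D)] parametrises two consecutive eigenvalues. *)
Lemma consecutive_parameters i : (i < D)%N -> exists2 eta : C, eta != 0 &
  [/\ th i = eta / q + q / eta, th i.+1 = eta * q + (eta * q)^-1 &
      t i.+1 = - t i / eta].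
Proof.
move=> iD; exists (a * q ^ (2 * i%:Z + 1 - D%:Z)).
  by rewrite mulf_neq0 ?expfz_neq0.
set X := q ^ _; have X0 : X != 0 by rewrite expfz_neq0.
have qD m n : q ^ m * q ^ n = q ^ (m + n) by rewrite expfzDr.
have qMr m : q ^ m * q = q ^ (m + 1) by rewrite -qD.
rewrite /vartheta /tau; split.
- have -> : q ^ (2 * i%:Z - D%:Z) = X / q.
    by rewrite /X -exprN1 qD; congr (q ^ _); lia.
  have -> : q ^ (D%:Z - 2 * i%:Z) = q / X.
    by rewrite /X invr_expz [q * _]mulrC qMr; congr (q ^ _); lia.
  by field; rewrite a_neq0 X0.
- have -> : q ^ (2 * i.+1%:Z - D%:Z) = X * q.
    by rewrite /X qMr; congr (q ^ _); lia.
  have -> : q ^ (D%:Z - 2 * i.+1%:Z) = (X * q)^-1.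
    by rewrite /X qMr invr_expz; congr (q ^ _); lia.
  by field; rewrite q_neq0 a_neq0 X0.
- have -> : q ^+ (i.+1 * (D - i.+1)) = q ^+ (i * (D - i)) / X.
    rewrite /X invr_expz !exprnP qD; congr (q ^ _).
    have -> : (D - i = (D - i.+1).+1)%N by lia.
    have -> : D%:Z = (D - i.+1)%:Z + i.+1%:Z by lia.
    rewrite !PoszM; lia.
  by rewrite !exprS; field; rewrite expf_neq0 // a_neq0 X0.
Qed.

(** The multiple of the q-commutator [q A B - q^-1 B A] that cancels the blocks next to the
    diagonal. *)
Definition kappa : C := (q ^+ 2 - q ^- 2)^-1.

Lemma q4_neq0 : q ^+ 4 - 1 != 0.
Proof.
rewrite -[4%N]/(2 * 2)%N exprM -[1](expr1n _ 2) subr_sqr mulf_neq0 //.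
  by rewrite subr_eq0.
by rewrite addr_eq0.
Qed.

Lemma kappaE : kappa = q ^+ 2 / (q ^+ 4 - 1).
Proof.
have := q4_neq0; rewrite /kappa => q4.
by field; rewrite q_neq0 q4 !andbT.
Qed.

(** This is the coefficient of the [(i, i.+1)] block, relative to the dual idempotents, of
    [T* A T*^-1] plus [kappa] times the q-commutator; relative to the [E i], with [T^-1 B T], it
    belongs to the [(i.+1, i)] block. *)
Lemma conj_coef_succ i : (i < D)%N ->
  t i / t i.+1 + kappa * (q * th i.+1 - q^-1 * th i) = 0.
Proof.
move=> /consecutive_parameters[eta eta0 [-> -> ->]]; rewrite kappaE.
by field; rewrite eta0 q4_neq0 q_neq0 tau_neq0.
Qed.

Lemma conj_coef_pred i : (i < D)%N ->
  t i.+1 / t i + kappa * (q * th i - q^-1 * th i.+1) = 0.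
Proof.
move=> /consecutive_parameters[eta eta0 [-> -> ->]]; rewrite kappaE.
by field; rewrite eta0 q4_neq0 q_neq0 tau_neq0.
Qed.

(** Since [q^2 - q^-2 = (q - q^-1)(q + q^-1)], the diagonal coefficient is exactly the weight in
    condition (star). *)
Lemma conj_coef_diag i :
  t i / t i + kappa * (q * th i - q^-1 * th i) = 1 + th i / (q + q^-1).
Proof.
rewrite kappaE divff ?tau_neq0 //; move: (vartheta _ _ _ _) => x.
have q2 : q ^+ 2 + 1 != 0 by rewrite addr_eq0.
have := q4_neq0 => q4.
by field; rewrite q_neq0 q2 q4.
Qed.

End QRacah.

(** * Distance matrices and dual idempotents *)

Section DistanceMatrices.
Variables (C : numClosedFieldType) (X : finType) (e : rel X) (D : nat).
Hypothesis graph_e : connected_simple_graph e.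
Local Notation n := #|X|.
Local Notation A := (dist_mx C e).
Local Notation d u v := (gdist e (enum_val u) (enum_val v)).
Local Notation Es x := (fun i : 'I_D.+1 => dual_idem C e x i).
Implicit Types (u v w : 'I_n) (x : X) (i j : 'I_D.+1) (h : nat -> C).

Lemma dual_blockE x (i j : nat) (M : 'M[C]_n) u v :
  (dual_idem C e x i *m M *m dual_idem C e x j) u v =
  (gdist e x (enum_val u) == i)%:R * (gdist e x (enum_val v) == j)%:R * M u v.
Proof. by rewrite mul_mx_diag mul_diag_mx !mxE mulrAC. Qed.

(** The distances from [x] to two adjacent vertices differ by at most one. *)
Lemma dual_tridiagonal x (i j : nat) : (i.+1 < j)%N || (j.+1 < i)%N ->
  dual_idem C e x i *m A 1 *m dual_idem C e x j = 0.
Proof.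
move=> far; apply/matrixP => u v; rewrite dual_blockE !mxE gdist_eq1 //.
case: eqP => [ui|]; last by rewrite !mul0r.
case: eqP => [vj|]; last by rewrite mulr0 mul0r.
case: (boolP (e _ _)) => [uv|]; last by rewrite mulr0.
have [se _ _] := graph_e; exfalso.
have := gdist_edge graph_e x uv.
rewrite se in uv; have := gdist_edge graph_e x uv.
rewrite !(gdist_sym graph_e _ x) ui vj; lia.
Qed.

(** A nonzero term would need vertices at distances [i] and [j] from a common vertex that are
    adjacent to each other. This is the intersection-number side of [krein_sum0]. *)
Lemma mxtrace_dist3 (i j : nat) : (i.+1 < j)%N || (j.+1 < i)%N ->
  \tr (A i *m A 1 *m A j) = 0.
Proof.
move=> far; rewrite /mxtrace big1 // => u _.
rewrite mxE big1 // => v _; rewrite mxE mulr_suml big1 // => w _.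
rewrite !mxE gdist_eq1 //.
case: eqP => [uw|]; last by rewrite !mul0r.
case: (boolP (e _ _)) => [wv|]; last by rewrite mulr0 mul0r.
case: eqP => [vu|]; last by rewrite mulr0.
have [se _ _] := graph_e; exfalso.
have := gdist_edge graph_e (enum_val u) wv.
rewrite se in wv; have := gdist_edge graph_e (enum_val u) wv.
rewrite (gdist_sym graph_e (enum_val w)) uw vu; lia.
Qed.

Hypotheses (diam_e : diameter e = D) (D_gt0 : (0 < D)%N).

Lemma card_gt0 : (0 < n)%N.
Proof.
rewrite lt0n; apply: contraTneq D_gt0 => /card0_eq X0.
rewrite -diam_e /diameter.
by rewrite big1 // => y; have := X0 y.
Qed.

Lemma gdist_leD x y : (gdist e x y <= D)%N.
Proof. by rewrite -diam_e gdist_le_diameter. Qed.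

Lemma sum_indicator (x y : X) h :
  \sum_(i < D.+1) h i * (gdist e x y == i)%:R = h (gdist e x y).
Proof.
pose i0 := Ordinal (gdist_leD x y : (gdist e x y < D.+1)%N).
rewrite (bigD1 i0) //= eqxx mulr1 big1 ?addr0 // => i /negPf.
by rewrite -val_eqE /= eq_sym => ->; rewrite mulr0.
Qed.

Lemma dual_spectralE x h :
  spectral (Es x) (fun i => h i) = diag_mx (\row_u h (gdist e x (enum_val u))).
Proof.
apply/matrixP => u v; rewrite summxE !mxE -sum_indicator -sumrMnl.
by apply: eq_bigr => i _; rewrite !mxE -mulrnAr.
Qed.

Lemma dual_resolution x : resolution (Es x).
Proof.
split=> [i j|].
  apply/matrixP => u v; rewrite -[dual_idem C e x i]mulmx1 dual_blockE.
  have [->|ij] := eqVneq i j; rewrite ?mulmx1 !mxE.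
    have [->|uv] := eqVneq u v; rewrite ?mulr0 ?mulr0n // mulr1 mulr1n.
    by case: eqP; rewrite ?mulr1 ?mulr0.
  have [->|uv] := eqVneq u v; rewrite ?mulr0 // mulr1.
  by case: eqP => [->|]; rewrite ?mul0r // val_eqE (negPf ij) mulr0.
transitivity (spectral (Es x) (fun=> 1)).
  by apply: eq_bigr => i _; rewrite scale1r.
rewrite (dual_spectralE x (fun=> 1)) -[RHS]/(scalar_mx 1) -diag_const_mx.
by congr diag_mx; apply/rowP => u; rewrite !mxE.
Qed.

(* The eigenvalue equation at a vertex at distance [k] from [z] that has a
   neighbour at distance [k.+1] determines [c k.+1] from the earlier values. *)
Lemma eigenmatrix_diag0 (c : nat -> C) th (F : 'M[C]_n) :
  (forall u v, F u v = c (d u v)) -> c 0%N = 0 -> A 1 *m F = th *: F -> F = 0.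
Proof.
move=> Fc c0 AF.
suff ck k : (k <= D)%N -> c k = 0.
  by apply/matrixP => u v; rewrite Fc ck ?gdist_leD // mxE.
elim/ltn_ind: k => [[//|k] IH kD].
have [y [z dyz]] : exists y z, gdist e y z = k.+1.
  by apply: gdist_attained; rewrite ?card_gt0 // diam_e.
have [w yw dwz] := gdist_step graph_e dyz.
have /matrixP/(_ (enum_rank w) (enum_rank z)) := AF.
rewrite !mxE Fc !enum_rankK dwz IH ?mulr0 //; last exact: ltnW.
under eq_bigr => u _.
  rewrite mxE Fc !enum_rankK gdist_eq1 //.
  (* A neighbour of [w] is at distance at most [k.+1] from [z]; if nearer, its term vanishes by
     induction. *)
  have -> : (e w (enum_val u))%:R * c (gdist e (enum_val u) z) =
    c k.+1 * (e w (enum_val u) && (gdist e (enum_val u) z == k.+1))%:R.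
    case: (boolP (e _ _)) => [wu|]; last by rewrite mul0r mulr0.
    case: eqP => [->|ne]; rewrite ?mul1r ?mulr1 // mulr0.
    have [se _ _] := graph_e; rewrite se in wu.
    have := gdist_edge graph_e z wu; rewrite dwz => le.
    by apply: IH; lia.
  over.
rewrite -mulr_sumr -natr_sum => /eqP.
rewrite mulf_eq0 pnatr_eq0 => /orP[/eqP //|].
(* The vertex [y] is counted, so the factor multiplying [c k.+1] is not zero. *)
rewrite (bigD1 (enum_rank y)) //= enum_rankK dyz eqxx andbT.
by have [se _ _] := graph_e; rewrite se yw.
Qed.

End DistanceMatrices.

(** * Primitive idempotents of a formally self-dual scheme *)

Section SelfDualScheme.
Variables (C : numClosedFieldType) (X : finType) (e : rel X) (D : nat).
Hypotheses (graph_e : connected_simple_graph e) (diam_e : diameter e = D).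
Hypothesis D_gt0 : (0 < D)%N.
Variables (E : 'I_D.+1 -> 'M[C]_#|X|) (P : 'M[C]_D.+1) (theta : 'I_D.+1 -> C).
Hypothesis E_ord : primitive_idempotent_ordering e E.
Hypothesis PP_eig : eigenmatrices e E P P.
Hypothesis A_theta : dist_mx C e 1 = \sum_i theta i *: E i.
Local Notation n := #|X|.
Local Notation A := (dist_mx C e).
Local Notation d u v := (gdist e (enum_val u) (enum_val v)).
Implicit Types (u v w : 'I_n) (x : X) (i j : 'I_D.+1) (h : nat -> C).

Let n_neq0 : n%:R != 0 :> C.
Proof. by rewrite pnatr_eq0 -lt0n (card_gt0 diam_e D_gt0). Qed.

Let inord_ord0 : inord 0 = ord0 :> 'I_D.+1.
Proof. by apply: val_inj; rewrite /= inordK. Qed.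

Lemma primitive_resolution : resolution E.
Proof. by have [_ _ EE E1 _] := E_ord. Qed.

Lemma primitive_neq0 i : E i != 0.
Proof.
have [_ /(_ (E i))[_ prim] _ _ _] := E_ord.
by have [|] := prim; first by exists i.
Qed.

Lemma dist_mx_primitive i j : A i *m E j = P j i *: E j.
Proof.
by rewrite (proj1 PP_eig) (spectral_mulr (P^~ i) j primitive_resolution).
Qed.

Lemma eigenvalueE i : P i (inord 1) = theta i.
Proof.
have := dist_mx_primitive (inord 1) i; rewrite inordK // A_theta.
rewrite (spectral_mulr theta i primitive_resolution) => /eqP.
rewrite -subr_eq0 -scalerBl scaler_eq0 (negPf (primitive_neq0 i)) orbF subr_eq0.
by move/eqP.
Qed.

(** Self-duality enters here: [P] also expands the idempotents in the distance matrices. *)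
Lemma primitiveE i u v : E i u v = n%:R^-1 * P (inord (d u v)) i.
Proof.
rewrite (proj2 PP_eig) !mxE summxE; congr (_ * _).
rewrite -(sum_indicator diam_e _ _ (fun k => P (inord k) i)).
by apply: eq_bigr => k _; rewrite !mxE inord_val.
Qed.

Lemma primitive_sym i u v : E i u v = E i v u.
Proof. by rewrite !primitiveE gdist_sym. Qed.

Lemma tr_primitive i : (E i)^T = E i.
Proof. by apply/matrixP => u v; rewrite mxE primitive_sym. Qed.

(** If [theta i = theta j], the combination of [E i] and [E j] with zero diagonal is an eigenmatrix,
    hence 0 by [eigenmatrix_diag0]; yet its product with [E i] is nonzero. *)
Lemma theta_inj : injective theta.
Proof.
move=> i j tij; apply/eqP; apply: contraT => ij.
have AE k : A 1 *m E k = theta k *: E k.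
  by rewrite A_theta (spectral_mulr theta k primitive_resolution).
have P0 k : P ord0 k != 0.
  apply: contra_neq (primitive_neq0 k) => Pk.
  pose c m := n%:R^-1 * P (inord m) k.
  apply: (@eigenmatrix_diag0 _ _ _ _ graph_e diam_e D_gt0 c _ _ _ _ (AE k)).
    exact: primitiveE.
  by rewrite /c inord_ord0 Pk mulr0.
have F0 : P ord0 j *: E i - P ord0 i *: E j = 0.
  pose c k := n%:R^-1 * (P ord0 j * P (inord k) i - P ord0 i * P (inord k) j).
  apply: (@eigenmatrix_diag0 _ _ _ _ graph_e diam_e D_gt0 c (theta i)).
  - move=> u v.
    by rewrite !mxE !primitiveE /c; ring.
  - by rewrite /c inord_ord0; ring.
  - rewrite mulmxBr -!scalemxAr !AE -tij scalerBr !scalerA.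
    by congr (_ *: _ - _ *: _); ring.
have := congr1 (mulmx (E i)) F0.
rewrite mulmxBr -!scalemxAr !(proj1 primitive_resolution) eqxx (negPf ij).
rewrite mulmx0 scaler0 subr0 => /eqP; rewrite scaler_eq0 (negPf (P0 j)).
by rewrite (negPf (primitive_neq0 i)).
Qed.

(** Compare diagonal entries in [A i *m E ord0 = P ord0 i *: E ord0], where [E ord0] is a multiple
    of the all-ones matrix. *)
Lemma valency u i : \sum_(v < n) (d u v == i)%:R = P ord0 i :> C.
Proof.
have /matrixP/(_ u u) := dist_mx_primitive i ord0.
have [_ _ _ _ ->] := E_ord; rewrite !mxE mulr1 => eq_row.
apply: (mulIf (invr_neq0 n_neq0)); rewrite -eq_row mulr_suml.
by apply: eq_bigr => v _; rewrite !mxE mulr1.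
Qed.

Lemma sum_gdist u h : \sum_(v < n) h (d u v) = \sum_(i < D.+1) h i * P ord0 i.
Proof.
under eq_bigr => v _ do rewrite -(sum_indicator diam_e).
by rewrite exchange_big; apply: eq_bigr => i _; rewrite -mulr_sumr valency.
Qed.

Lemma mxtrace_primitive i : \tr (E i) = P ord0 i.
Proof.
rewrite /mxtrace; under eq_bigr => u _ do rewrite primitiveE.
under eq_bigr => u _.
  rewrite (_ : d u u = 0%N); last by apply/eqP; rewrite gdist_eq0.
  over.
by rewrite inord_ord0 sumr_const card_ord -[_ *+ #|X|]mulr_natl mulVKf.
Qed.

Local Notation conjE i := (map_mx Num.conj (E i)).

(* The entrywise conjugates of the [E j] lie in the span of the [E k], and
   [conjE j *m E j] has the squared norms of the rows of [E j] on its
   diagonal. *)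
Lemma conj_primitive i u v : Num.conj (E i u v) = E i u v.
Proof.
have EE := proj1 primitive_resolution.
have ccE k l : conjE k *m conjE l = if k == l then conjE k else 0.
  by rewrite -map_mxM EE; case: eqP => // _; rewrite map_mx0.
have scal k j : exists c, conjE k *m E j = c *: E j.
  exists (\sum_l n%:R^-1 * Num.conj (P l k) * P j l).
  rewrite scaler_suml.
  have -> : conjE k = \sum_l (n%:R^-1 * Num.conj (P l k)) *: A l.
    rewrite {1}(proj2 PP_eig); apply/matrixP => y z.
    rewrite !(mxE, summxE) rmorphM /= fmorphV rmorph_nat rmorph_sum mulr_sumr.
    by apply: eq_bigr => l _; rewrite !mxE rmorphM /= rmorph_nat mulrA.
  rewrite mulmx_suml; apply: eq_bigr => l _.
  by rewrite -scalemxAl dist_mx_primitive scalerA.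
have conjEE j : conjE j *m E j = E j.
  have [c ec] := scal j j.
  have c0 : c != 0.
    apply: contra_neq (primitive_neq0 j) => c0.
    move: ec; rewrite c0 scale0r => ec.
    apply/matrixP => y z; have /matrixP/(_ y y) := ec; rewrite !mxE.
    under eq_bigr => w _ do rewrite mxE (primitive_sym j w) mulrC -normCK.
    move/eqP; rewrite psumr_eq0 => [/allP/(_ z)|w _]; last by rewrite exprn_ge0.
    by rewrite mem_index_enum expf_eq0 normr_eq0 => /(_ isT)/andP[_ /eqP].
  (* Multiplying by the idempotent [conjE j] gives [c = c^2]. *)
  have := congr1 (mulmx (conjE j)) ec.
  rewrite mulmxA ccE eqxx -scalemxAr ec scalerA => /eqP.
  rewrite -subr_eq0 -scalerBl scaler_eq0 (negPf (primitive_neq0 j)) orbF.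
  rewrite -{1}[c]mulr1 -mulrBr mulf_eq0 (negPf c0) subr_eq0 => /eqP <-.
  by rewrite scale1r.
suff /matrixP/(_ u v) : conjE i = E i by rewrite mxE.
rewrite -[LHS]mulmx1 -(proj2 primitive_resolution) mulmx_sumr.
rewrite (bigD1 i) //= conjEE.
(* For [j != i], write [E j] as [conjE j *m E j]; [conjE i] annihilates the first factor. *)
rewrite big1 ?addr0 // => j ji.
by rewrite -[E j]conjEE mulmxA ccE eq_sym (negPf ji) mul0mx.
Qed.

(* The sum of the entries of the entrywise product of [E i], [E 1], [E j]
   is, by self-duality, a multiple of [\tr (A i *m A 1 *m A j)]. *)
Lemma krein_sum0 i j : (i.+1 < j)%N || (j.+1 < i)%N ->
  \sum_u \sum_v E i u v * E (inord 1) u v * E j u v = 0.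
Proof.
move=> far.
pose s := \sum_k P k i * P k (inord 1) * P k j * P ord0 k.
have -> : \sum_u \sum_v E i u v * E (inord 1) u v * E j u v =
          n%:R * (n%:R^-1 ^+ 3 * s).
  transitivity (\sum_(u < n) (n%:R^-1 ^+ 3 * s)); last first.
    by rewrite sumr_const card_ord mulr_natl.
  apply: eq_bigr => u _.
  pose h k := P (inord k) i * P (inord k) (inord 1) * P (inord k) j.
  transitivity (n%:R^-1 ^+ 3 * \sum_(v < n) h (d u v)).
    by rewrite mulr_sumr; apply: eq_bigr => v _; rewrite !primitiveE /h; ring.
  rewrite sum_gdist /s; congr (_ * _).
  by apply: eq_bigr => k _; rewrite /h inord_val.
suff -> : s = 0 by rewrite !mulr0.
(* On [E k] the product [A i *m A 1 *m A j] acts as a scalar, and [\tr (E k) = P ord0 k]; the trace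
   is therefore [s]. *)
rewrite -(mxtrace_dist3 C graph_e far).
rewrite -[A j]mulmx1 -(proj2 primitive_resolution).
rewrite mulmx_sumr mulmx_sumr raddf_sum; apply: eq_bigr => k _ /=.
rewrite dist_mx_primitive -scalemxAr -mulmxA.
have -> : A 1 *m E k = P k (inord 1) *: E k.
  by rewrite -dist_mx_primitive inordK.
rewrite -scalemxAr dist_mx_primitive !scalerA mxtraceZ mxtrace_primitive.
by ring.
Qed.

(* Summing over the base vertex the squared norms of [E i *m A^* *m E j]
   gives the sum of [krein_sum0]. *)
Lemma primitive_tridiagonal x i j : (i.+1 < j)%N || (j.+1 < i)%N ->
  E i *m dual_adj E x *m E j = 0.
Proof.
move=> far.
pose Dg w := diag_mx (row w (E (inord 1))).
have -> : dual_adj E x = n%:R *: Dg (enum_rank x).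
  apply/matrixP => u v; rewrite !mxE mulrnAr; congr (_ *+ _).
rewrite -scalemxAr -scalemxAl; move: (enum_rank x) => w.
suff -> : E i *m Dg w *m E j = 0 by rewrite scaler0.
pose N w := E i *m Dg w *m E j.
have trDg y : (Dg y)^T = Dg y by rewrite tr_diag_mx.
have realN y : map_mx Num.conj (N y) = N y.
  rewrite /N !map_mxM map_diag_mx; congr (_ *m diag_mx _ *m _);
  by apply/matrixP => u v; rewrite !mxE; apply: conj_primitive.
have realNe y u v : Num.conj (N y u v) = N y u v.
  by have /matrixP/(_ u v) := realN y; rewrite mxE.
(* [N y] is real, so its squared norm is [\tr (N y *m (N y)^T)]; cyclicity and idempotence remove
   the repeated [E i] and [E j]. *)
have normN y : \sum_u \sum_v `|N y u v| ^+ 2 =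
    \sum_u \sum_v E i u v * E j u v * (E (inord 1) y u * E (inord 1) y v).
  transitivity (\tr (E i *m Dg y *m E j *m Dg y)).
    transitivity (\tr (N y *m (N y)^T)).
      rewrite /mxtrace; apply: eq_bigr => u _; rewrite mxE.
      apply: eq_bigr => v _.
      by rewrite normCK realNe; congr (_ * _); rewrite [RHS]mxE.
    rewrite /N !trmx_mul trDg !tr_primitive !mulmxA.
    rewrite -(mulmxA _ (E j) (E j)) (proj1 primitive_resolution) eqxx.
    by rewrite mxtrace_mulC !mulmxA (proj1 primitive_resolution) eqxx.
  rewrite /mxtrace; apply: eq_bigr => u _.
  rewrite mul_mx_diag mxE mxE mulr_suml; apply: eq_bigr => v _.
  by rewrite mul_mx_diag !mxE (primitive_sym j v); ring.
have : \sum_y \sum_u \sum_v `|N y u v| ^+ 2 = 0.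
  under eq_bigr => y _ do rewrite normN.
  rewrite exchange_big /= -[RHS](krein_sum0 far); apply: eq_bigr => u _.
  rewrite exchange_big /=; apply: eq_bigr => v _.
  rewrite -mulr_sumr mulrAC; congr (_ * _ * _).
  (* Idempotence and symmetry of [E (inord 1)] collapse the sum over [y]. *)
  have /matrixP/(_ u v) := proj1 primitive_resolution (inord 1) (inord 1).
  rewrite eqxx mxE => <-; apply: eq_bigr => y _.
  by rewrite (primitive_sym _ y u).
have nn0 y : 0 <= \sum_u \sum_v `|N y u v| ^+ 2.
  by do 2!(apply: sumr_ge0 => ? _); rewrite exprn_ge0.
move/eqP; rewrite psumr_eq0 // => /allP/(_ w).
rewrite mem_index_enum => /(_ isT) /=.
rewrite psumr_eq0 => [/allP Nw|u _]; last first.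
  by apply: sumr_ge0 => ? _; rewrite exprn_ge0.
apply/matrixP => u v; rewrite [RHS]mxE.
have := Nw u; rewrite mem_index_enum => /(_ isT) /=.
rewrite psumr_eq0 => [/allP/(_ v)|? _]; last by rewrite exprn_ge0.
by rewrite mem_index_enum expf_eq0 normr_eq0 => /(_ isT)/andP[_ /eqP].
Qed.

(** By self-duality the dual eigenvalues are again the [theta i]. *)
Lemma dual_adjE x :
  dual_adj E x = spectral (fun i : 'I_D.+1 => dual_idem C e x i) theta.
Proof.
transitivity (spectral (fun i : 'I_D.+1 => dual_idem C e x i)
                (fun i => theta (inord i))).
  rewrite (dual_spectralE diam_e x (fun k => theta (inord k))).
  congr diag_mx; apply/rowP => u.
  by rewrite !mxE primitiveE enum_rankK eigenvalueE mulVKf.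
by apply: eq_bigr => i _; rewrite inord_val.
Qed.

(** * From condition (star) to the braid relation and the spin model *)

Section Braid.
Variables (q a alpha eps : C).
Hypotheses (q_neq0 : q != 0) (q2_neq1 : q ^+ 2 != 1) (q2_neqN1 : q ^+ 2 != -1).
Hypotheses (a_neq0 : a != 0) (alpha_neq0 : alpha != 0).
Hypothesis theta_def : forall i, theta i = alpha * vartheta D q a i + eps.
Hypothesis star : forall x, condition_star e E q a alpha eps x.
Local Notation t := (fun i : 'I_D.+1 => tau D q a i).
Local Notation th := (fun i : 'I_D.+1 => vartheta D q a i).
Local Notation Es x := (fun i : 'I_D.+1 => dual_idem C e x i).
Local Notation T := (spectral E t).
Local Notation Ts x := (spectral (Es x) t).

Lemma normalized_spectral (F : 'I_D.+1 -> 'M[C]_n) : resolution F ->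
  alpha^-1 *: (spectral F theta - eps%:M) = spectral F th.
Proof.
move=> rF; apply: (resolution_extr rF) => j.
rewrite -scalemxAl mulmxBl !spectral_mulr // mul_scalar_mx -scalerBl scalerA.
by rewrite theta_def addrK mulKf.
Qed.

Lemma normalized_tridiagonal (F G : 'I_D.+1 -> 'M[C]_n) i j : resolution F ->
  i != j -> F i *m spectral G theta *m F j = 0 ->
  F i *m (alpha^-1 *: (spectral G theta - eps%:M)) *m F j = 0.
Proof.
move=> rF ij F0; rewrite -scalemxAr -scalemxAl mulmxBr mulmxBl F0 sub0r.
by rewrite mul_mx_scalar -scalemxAl (proj1 rF) (negPf ij) scaler0 oppr0 scaler0.
Qed.

Let far_or_adjacent i j : i != j ->
  (i.+1 < j)%N || (j.+1 < i)%N \/ (j = i.+1 :> nat) \/ (i = j.+1 :> nat).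
Proof. by rewrite -val_eqE /=; lia. Qed.

(* Both sides of condition (star) are, up to the same multiple of a
   [q]-commutator, conjugates by [T^-1] and [Ts x]. *)
Lemma swap_conj x :
  T *m Ts x *m spectral E th = spectral (Es x) th *m T *m Ts x.
Proof.
have rE := primitive_resolution; have rEs := dual_resolution C diam_e x.
have t0 i : t i != 0 by apply: tau_neq0.
pose kap := kappa q.
set AA := spectral E th; set BB := spectral (Es x) th.
have AAE : AA = alpha^-1 *: (A 1 - eps%:M).
  by rewrite A_theta normalized_spectral.
have BBE : BB = alpha^-1 *: (dual_adj E x - eps%:M).
  by rewrite dual_adjE normalized_spectral.
pose w i := 1 + vartheta D q a i / (q + q^-1).
have := star x; rewrite /condition_star -AAE -BBE.
have -> : \sum_i w i *: (E i *m BB *m E i) =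
    spectral E (fun i => (t i)^-1) *m BB *m T +
    spectral E (fun i => kap * q * th i) *m BB +
    BB *m spectral E (fun i => - kap * q^-1 * th i).
  apply: block_diag_spectral => // i j.
  have [<-|ij] := eqVneq i j.
    congr (_ *: _); rewrite /w.
    rewrite -(conj_coef_diag D q_neq0 q2_neq1 q2_neqN1 a_neq0).
    by rewrite -/kap; ring.
  have [far|adj] := far_or_adjacent ij.
    rewrite BBE dual_adjE normalized_tridiagonal ?scaler0 //.
    by rewrite -dual_adjE primitive_tridiagonal.
  (* A block next to the diagonal may be nonzero; it is its coefficient that vanishes. *)
  rewrite (_ : _ + _ + _ = 0) ?scale0r //.
  transitivity (t j / t i + kap * (q * th i - q^-1 * th j)); first by ring.
  case: adj => [eij|eij] /=; rewrite eij.
    by rewrite conj_coef_pred // -ltnS -eij.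
  by rewrite conj_coef_succ // -ltnS -eij.
have -> : \sum_(i < D.+1)
      w i *: (dual_idem C e x i *m AA *m dual_idem C e x i) =
    Ts x *m AA *m spectral (Es x) (fun i => (t i)^-1) +
    spectral (Es x) (fun i => - kap * q^-1 * th i) *m AA +
    AA *m spectral (Es x) (fun i => kap * q * th i).
  apply: (block_diag_spectral (F := Es x)) => // i j.
  have [<-|ij] := eqVneq i j.
    congr (_ *: _); rewrite /w.
    rewrite -(conj_coef_diag D q_neq0 q2_neq1 q2_neqN1 a_neq0).
    by rewrite -/kap; ring.
  have [far|adj] := far_or_adjacent ij.
    rewrite AAE A_theta (normalized_tridiagonal rEs) ?scaler0 //.
    by rewrite -[spectral _ _]A_theta dual_tridiagonal.
  rewrite (_ : _ + _ + _ = 0) ?scale0r //.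
  transitivity (t i / t j + kap * (q * th j - q^-1 * th i)); first by ring.
  case: adj => [eij|eij] /=; rewrite eij.
    by rewrite conj_coef_succ // -ltnS -eij.
  by rewrite conj_coef_pred // -ltnS -eij.
have scal (F : 'I_D.+1 -> 'M[C]_n) c :
    spectral F (fun i => c * th i) = c *: spectral F th.
  by rewrite scaler_sumr; apply: eq_bigr => i _; rewrite scalerA.
(* The q-commutator terms on the two sides agree up to order and cancel. *)
rewrite !scal -/AA -/BB -!scalemxAl -!scalemxAr -!addrA.
rewrite [X in _ + X = _]addrC => /addIr eq_conj.
have := congr1 (fun M => T *m M *m Ts x) eq_conj.
rewrite !mulmxA spectralV // mul1mx => <-.
have sV := spectralV rEs t0; have /mulmx1C sV' := sV.
by rewrite -!mulmxA sV' mulmx1.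
Qed.

Lemma vartheta_inj : injective th.
Proof. by move=> i j /= eij; apply: theta_inj; rewrite !theta_def eij. Qed.

(** [T *m Ts x] intertwines two matrices with the same pairwise distinct eigenvalues, so it matches
    their eigenprojections. *)
Lemma swap_idem x i : dual_idem C e x i *m (T *m Ts x) = T *m Ts x *m E i.
Proof.
have rEs := dual_resolution C diam_e x.
apply: (intertwine_idem primitive_resolution rEs vartheta_inj).
by rewrite mulmxA -swap_conj.
Qed.

Lemma braid x : T *m Ts x *m T = Ts x *m T *m Ts x.
Proof.
have rT M : M *m T = \sum_i t i *: (M *m E i).
  by rewrite mulmx_sumr; apply: eq_bigr => i _; rewrite -scalemxAr.
have lTs M : Ts x *m M = \sum_(i < D.+1) t i *: (dual_idem C e x i *m M).
  by rewrite mulmx_suml; apply: eq_bigr => i _; rewrite -scalemxAl.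
by rewrite rT -mulmxA lTs; apply: eq_bigr => i _; rewrite swap_idem.
Qed.

Lemma tr_spectral h :
  (spectral E (fun i : 'I_D.+1 => h i))^T =
  spectral E (fun i : 'I_D.+1 => h i).
Proof.
rewrite /spectral linear_sum; apply: eq_bigr => i _ /=.
by rewrite linearZ /= tr_primitive.
Qed.

(** The [(v, w)] entry of [swap_idem] at index 0 and base vertex [u]: the dual idempotent keeps only
    row [u], and [E ord0] makes the right side independent of [w]. *)
Lemma swap_row u v w :
  (u == v)%:R * (T v w * tau D q a (d u w)) =
  n%:R^-1 * \sum_y T v y * tau D q a (d u y).
Proof.
have /matrixP/(_ v w) := swap_idem (enum_val u) ord0.
rewrite (dual_spectralE diam_e) mul_mx_diag mul_diag_mx !mxE /=.
rewrite gdist_eq0 // (inj_eq enum_val_inj) => ->.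
have [_ _ _ _ ->] := E_ord; rewrite mulr_sumr; apply: eq_bigr => y _.
by rewrite !mxE mulr1 mulrC.
Qed.

(** By [swap_row] the left side does not depend on [v]; at [v = u] it is [T u u], and the diagonal
    of [T] is constant. *)
Lemma spectral_tau_entry u v w : T u v * tau D q a (d u v) = T w w.
Proof.
have [c cE] : exists c : nat -> C, forall y z, T y z = c (d y z).
  exists (fun k => \sum_i t i * (n%:R^-1 * P (inord k) i)) => y z.
  by rewrite summxE; apply: eq_bigr => i _; rewrite mxE primitiveE.
have duu y : d y y = 0%N by apply/eqP; rewrite gdist_eq0.
have -> : T w w = T u u by rewrite !cE !duu.
have row z :
    T u z * tau D q a (d u z) = n%:R^-1 * \sum_y T u y * tau D q a (d u y).
  by rewrite -(swap_row u u z) eqxx mul1r.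
by rewrite row -(row u) duu tau0 mulr1.
Qed.

(** As [tau] is a constant over the entry of [T], this is the off-diagonal part of the type II
    condition. *)
Lemma spectral_tau_orthogonal u v :
  u != v -> \sum_y T v y * tau D q a (d u y) = 0.
Proof.
move=> /negPf uv; have := swap_row u v u; rewrite uv mul0r => /esym/eqP.
by rewrite mulf_eq0 invr_eq0 (negPf n_neq0) => /eqP.
Qed.

(** The all-ones vector spans the image of [E ord0], where [T] acts as [tau 0 = 1]. *)
Lemma spectral_tau_row u : \sum_y T u y = 1.
Proof.
have /matrixP/(_ u u) := spectral_mulr t ord0 primitive_resolution.
have [_ _ _ _ ->] := E_ord; rewrite tau0 scale1r !mxE mulr1 => eq_row.
apply: (mulIf (invr_neq0 n_neq0)); rewrite mul1r -[RHS]eq_row mulr_suml.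
by apply: eq_bigr => y _; rewrite !mxE mulr1.
Qed.

(** Once [tau] is rewritten through the entries of [T], the left side is the spin model sum with [u]
    indexing the denominator. *)
Lemma braid_entry u v w :
  \sum_y T v y * tau D q a (d u y) * T y w =
  tau D q a (d u v) * T v w * tau D q a (d u w).
Proof.
have /matrixP/(_ v w) := braid (enum_val u).
rewrite (dual_spectralE diam_e) mul_mx_diag mul_mx_diag mul_diag_mx !mxE => <-.
by apply: eq_bigr => y _; rewrite !mxE.
Qed.

Theorem spin_model_spectral_tau (p : nat -> nat -> nat -> nat) f :
  distance_regular e p -> f != 0 ->
  spin_model (f *: T) <->
  f ^+ 2 = sqrtC n%:R * \sum_(i < D.+1) (t i)^-1 * (p 0%N i i)%:R.
Proof.
move=> dr_e f0; have t0 k : tau D q a k != 0 by apply: tau_neq0.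
pose u0 : 'I_n := Ordinal (card_gt0 diam_e D_gt0).
pose s := T u0 u0.
have TE u v : T u v = s / tau D q a (d u v).
  by rewrite /s -(spectral_tau_entry u v u0) mulfK.
set S := \sum_(i < D.+1) _.
have sS : s * S = 1.
  rewrite -(spectral_tau_row u0); under [RHS]eq_bigr => y _ do rewrite TE.
  rewrite -mulr_sumr (sum_gdist u0 (fun k => (tau D q a k)^-1)).
  congr (_ * _); apply: eq_bigr => i _; congr (_ * _).
  (* [p 0 i i] counts the sphere of radius [i] around a vertex, intersected with itself. *)
  rewrite -(valency u0) -(dr_e 0%N i i _ _ _ (enum_val u0) (enum_val u0)).
  - rewrite setIid -sum1_card natr_sum big_mkcond /=.
    pose r y : C := (gdist e (enum_val u0) y == i)%:R.
    rewrite -(big_enum_val (A := X) r) /=.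
    by apply: eq_bigr => y _; rewrite inE /r; case: eqP.
  - by [].
  - by rewrite diam_e -ltnS.
  - by rewrite diam_e -ltnS.
  - by apply/eqP; rewrite gdist_eq0.
have s0 : s != 0.
  by apply: contra_eq_neq sS => ->; rewrite mul0r eq_sym oner_eq0.
have Tsym u v : T u v = T v u by rewrite -[in LHS](tr_spectral (tau D q a)) mxE.
have T0 u v : T u v != 0 by rewrite TE mulf_neq0 ?invr_neq0.
have spinE b c z : \sum_u (f *: T) u c * (f *: T) u z / (f *: T) u b =
    f / s * (tau D q a (d b c) * T c z * tau D q a (d b z)).
  rewrite -braid_entry mulr_sumr; apply: eq_bigr => u _.
  rewrite !mxE -!/(T _ _) (Tsym u b) (Tsym u c) (TE b u); field.
  by rewrite f0 s0 t0.
have rhsE b c z : (f *: T) c z / ((f *: T) b c * (f *: T) z b) =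
    (f * s ^+ 2)^-1 * (tau D q a (d b c) * T c z * tau D q a (d b z)).
  rewrite !mxE (Tsym z b) (TE b c) (TE b z); field.
  by rewrite f0 s0 !t0.
(* Equality of the scalars that [spinE] and [rhsE] put before one common expression. *)
have f2E : f ^+ 2 = sqrtC n%:R * S <-> f / s = sqrtC n%:R * (f * s ^+ 2)^-1.
  have -> : S = s^-1 by apply: (mulfI s0); rewrite sS mulfV.
  split=> eqf.
    apply: (mulfI f0); rewrite mulrA -expr2 eqf; field.
    by rewrite s0 f0.
  apply: (mulIf (invr_neq0 s0)); rewrite expr2 -!mulrA eqf; field.
  by rewrite s0 f0.
(* A single triple suffices for necessity, since the common expression is nonzero. *)
rewrite f2E; split=> [[_ _ /(_ u0 u0 u0)]|eqf].
  rewrite spinE rhsE [RHS]mulrA => eqf; apply: mulIf eqf.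
  exact: mulf_neq0 (mulf_neq0 (t0 _) (T0 _ _)) (t0 _).
split.
- by rewrite linearZ /= (tr_spectral (tau D q a)).
- split=> [b c|]; first by rewrite mxE mulf_neq0.
  exists n%:R; apply/matrixP => b c; rewrite !mxE.
  transitivity (s^-1 * \sum_y T b y * tau D q a (d c y)).
    rewrite mulr_sumr; apply: eq_bigr => y _; rewrite !mxE (TE c y); field.
    by rewrite f0 s0 t0.
  have [<-|bc] := eqVneq b c; last first.
    by rewrite spectral_tau_orthogonal ?mulr0 // eq_sym.
  under eq_bigr => y _ do rewrite (spectral_tau_entry b y u0).
  by rewrite sumr_const card_ord mulr1n -/s -[s *+ _]mulr_natr mulKf.
- by move=> b c z; rewrite spinE rhsE eqf -[LHS]mulrA.
Qed.

End Braid.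
End SelfDualScheme.

Theorem theorem14p3 (R : realType) (X : finType) (e : rel X) (D : nat)
    (p : nat -> nat -> nat -> nat)
    (E : 'I_D.+1 -> 'M[complex R]_#|X|)
    (theta : 'I_D.+1 -> complex R) (P Q : 'M[complex R]_D.+1)
    (q a alpha eps f : complex R)
    (graph_e : connected_simple_graph e)
    (diam_e : diameter e = D) (D_ge3 : (3 <= D)%N)
    (dr_e : distance_regular e p)
    (E_ord : primitive_idempotent_ordering e E)
    (A_theta : dist_mx (complex R) e 1 = \sum_i theta i *: E i)
    (PQ_eig : eigenmatrices e E P Q)
    (self_dual : P = Q)
    (q_neq0 : q != 0) (q2_neq1 : q ^+ 2 != 1) (q2_neqN1 : q ^+ 2 != -1)
    (a_neq0 : a != 0) (alpha_neq0 : alpha != 0)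
    (theta_def : forall i, theta i = alpha * vartheta D q a i + eps)
    (star : forall x : X, condition_star e E q a alpha eps x)
    (f_neq0 : f != 0) :
  spin_model (f *: \sum_(i < D.+1) tau D q a i *: E i) <->
  f ^+ 2 = sqrtC #|X|%:R * \sum_(i < D.+1) (tau D q a i)^-1 * (p 0%N i i)%:R.
Proof.
case: PQ_eig => A_eig E_eig; rewrite -self_dual in E_eig.
have D_gt0 : (0 < D)%N by apply: leq_trans D_ge3.
exact: (spin_model_spectral_tau graph_e diam_e D_gt0 E_ord (conj A_eig E_eig)
          A_theta q_neq0 q2_neq1 q2_neqN1 a_neq0 alpha_neq0 theta_def star
          dr_e f_neq0).
Qed.
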